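(* Let $p_0,p_1,\ldots,p_n$ be positive real numbers with $\sum_{i=0}^n p_i=1$, the probabilities of the letters $\omega_0,\omega_1,\ldots,\omega_n$, where $\omega_0$ is the stop symbol, and let $p(r)$ be the probability of the $r$th word in the list of all words sorted in non-increasing order of their probabilities. Suppose that at least one of the ratios $\log p_i/\log p_j$, $i,j\in\{1,\ldots,n\}$, is irrational, and let $\gamma$ be the root of the equation $\sum_{i=1}^n p_i^\gamma=1$. Then the limit $$\lim_{r\to\infty}\frac{p(r)^{-\gamma}/p_0^{-\gamma}}{r}$$ exists and equals $H(\mathbf{p}^\gamma)$, where $H(\mathbf{p}^\gamma)=-\gamma\sum_{i=1}^n p_i^\gamma\ln p_i$ is the entropy of $\mathbf{p}^\gamma=(p_1^\gamma,\ldots,p_n^\gamma)$.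
   Context: A word is a finite sequence of symbols from $\{\omega_0,\ldots,\omega_n\}$ in which the stop symbol $\omega_0$ occurs exactly once, at the very end; i.e. a word consists of a finite (possibly empty) sequence of letters from $\omega_1,\ldots,\omega_n$ followed by $\omega_0$. The probability of a word is the product of the probabilities of all its symbols (including the final $\omega_0$, which contributes the factor $p_0$). All words are listed in non-increasing order of their probabilities (words of equal probability in arbitrary order), and $p(r)$, $r=1,2,\ldots$, is the probability of the $r$th word in this list. *)

(* Defs.v *)
From mathcomp Require Import all_boot all_order all_algebra.
From mathcomp Require Import all_classical all_reals all_analysis.

Set Implicit Arguments.
Unset Strict Implicit.
Unset Printing Implicit Defensive.

Import Order.TTheory GRing.Theory Num.Theory.
Import numFieldNormedType.Exports.

Local Open Scope classical_set_scope.
Local Open Scope ring_scope.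

(* The symbols omega_0, ..., omega_n are the elements
   of 'I_n.+1; the stop symbol omega_0 is ord0, and the n letters
   omega_1, ..., omega_n are the [lift ord0 i] for i : 'I_n. *)

Definition words (n : nat) : set (seq 'I_n.+1) :=
  [set w | exists2 s, ord0 \notin s & w = rcons s ord0].
Arguments words : clear implicits.

Definition word_prob (R : realType) (n : nat) (p : 'I_n.+1 -> R)
    (w : seq 'I_n.+1) : R :=
  \prod_(x <- w) p x.

(* [w r] is the r-th word of the list, r = 1, 2, ...; the value [w 0] is
   irrelevant.  The order among words of equal probability is unconstrained. *)
Definition sorted_word_list (R : realType) (n : nat) (p : 'I_n.+1 -> R)
    (w : nat -> seq 'I_n.+1) : Prop :=
  set_bij [set r | (0 < r)%N] (words n) w /\
  forall r s : nat, (0 < r)%N -> (r <= s)%N ->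
    word_prob p (w s) <= word_prob p (w r).

Definition entropy (R : realType) (I : finType) (q : I -> R) : R :=
  - \sum_(i : I) q i * ln (q i).

(* Main.v *)
Require Import Defs.
From mathcomp Require Import all_boot all_order all_algebra.
From mathcomp Require Import all_classical all_reals all_analysis.
From mathcomp Require Import ring lra.

Import Order.TTheory GRing.Theory Num.Theory.
Import numFieldNormedType.Exports.

Local Open Scope classical_set_scope.
Local Open Scope ring_scope.

(** Write [a i = - gamma * ln (p i)] for the letters other than the stop symbol.
    Then [a i > 0], the numbers [q i = expR (- a i)] sum to 1, and the entropy is
    the mean [H = \sum_i q i * a i].  Give a letter sequence [s] the weight
    [weight s], the sum of the [a i] over its letters.  A word spelling [s]
    satisfies [(prob / p ord0) `^ (- gamma) = expR (weight s)], so the list in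
    the theorem sorts the letter sequences by weight, and ranks are essentially
    values of the counting function [N x], the number of [s] with
    [weight s <= x].  Everything reduces to [N x ~ expR x / H], that is, to
    [Z x = expR (- x) * N x] tending to [H^-1] (Lemma [scaled_count_cvg]).

    Removing the first letter of a nonempty sequence shows that
    [Z x = expR (- x) + \sum_i q i * Z (x - a i)] for [0 <= x]: up to a vanishing
    term, [Z] at [x] is an average of earlier values of [Z].  This is a renewal
    equation, and the convergence is proved by three observations.

    - Let [L] be the limit superior of [Z], reached along some [u k].  An average
      of numbers asymptotically at most [L] can tend to [L] only if each of them
      does.  So [Z (u k - a i)] tends to [L], and by iteration so does
      [Z (u k - weight s)] for every [s] ([limsup_persists]).  The limit inferior
      behaves likewise.

    - As some ratio [a i / a j] is irrational, combinations [m * a i + k * a j]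
      with natural coefficients become arbitrarily dense far from 0
      ([weights_eventually_dense]).  Since [N] is nondecreasing,
      [Z x >= expR (- h) * Z (x - h)], so control of [Z] on a dense
      set of shifts is control on whole intervals.  Hence [Z] is nearly equal
      to [L] on all of a window of fixed length, at a fixed distance before [u k].

    - Let [K x] be the integral of [Z] up to [x].  The renewal equation gives the
      conservation law
      [\sum_i q i * (K x - K (x - a i)) = 1 - expR (- x)]
      ([cumulated_count_rec]).  On a window where [Z] is nearly [L], the left-hand
      side is nearly [L * H], so [L * H = 1] ([shifts_limit_mul_mean]).

    The limits superior and inferior are therefore both [H^-1].  The passage from
    [N] to ranks is [ranked_weight_cvg]: if [t] is the weight of the [r]th
    sequence, then [N y < r <= N t] for every [y < t]. *)

(** * Combinations of two numbers with irrational ratio *)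

Section IrrationalRatio.
Set Implicit Arguments.
Unset Strict Implicit.
Variable R : realType.

(** Dirichlet's pigeonhole argument: among the fractional parts of the first
    [N + 1] multiples of [x / y], two fall into the same interval of length
    [1 / N]. Irrationality makes their difference nonzero. *)
Lemma small_combination (x y d : R) :
  0 < x -> 0 < y -> irrational (x / y) -> 0 < d ->
  exists m k : nat, 0 < `|m%:R * x - k%:R * y| < d.
Proof.
move=> x_gt0 y_gt0 irr d_gt0; set c := x / y in irr.
have c_gt0 : 0 < c by exact: divr_gt0.
(* [N] intervals of length [1 / N]; multiplied by [y], that length is below [d]. *)
pose N := (Num.truncn (y / d)).+1.
have yN : y / N%:R < d.
  by rewrite ltr_pdivrMr ?ltr0n // mulrC -ltr_pdivrMr // truncnS_gt.
pose fl (m : nat) := Num.truncn (m%:R * c).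
pose fr (m : nat) := m%:R * c - (fl m)%:R.
have mc_ge0 m : 0 <= m%:R * c by rewrite mulr_ge0 ?ler0n ?ltW.
have fr_ge0 m : 0 <= fr m.
  by rewrite subr_ge0; have /andP[] := truncn_itv (mc_ge0 m).
have fr_lt1 m : fr m < 1.
  by rewrite ltrBlDr addrC natr1; have /andP[] := truncn_itv (mc_ge0 m).
have bucketP m : (Num.truncn (N%:R * fr m) < N)%N.
  rewrite truncn_lt_nat ?mulr_ge0 ?ler0n //.
  by rewrite -[ltRHS]mulr1 ltr_pM2l ?ltr0n.
pose bucket (m : 'I_N.+1) := Ordinal (bucketP m).
have [m [m' [mm' same]]] : exists m m' : nat, (m < m')%N /\
    Num.truncn (N%:R * fr m) = Num.truncn (N%:R * fr m').
  have /injectivePn[m [m' mm' /(congr1 val)/= bmm']] : ~~ injectiveb bucket.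
    by apply/negP => /injectiveP/leq_card; rewrite !card_ord ltnn.
  case: (ltngtP m m') => [lt|lt|/val_inj eq]; last by rewrite eq eqxx in mm'.
  - by exists m, m'.
  - by exists m', m.
have fl_le : (fl m <= fl m')%N.
  by apply: le_truncn; rewrite ler_pM2r // ler_nat ltnW.
exists (m' - m)%N, (fl m' - fl m)%N.
have -> : (m' - m)%:R * x - (fl m' - fl m)%:R * y = y * (fr m' - fr m).
  rewrite natrB ?(ltnW mm') // natrB // /fr.
  have -> : x = c * y by rewrite divfK ?gt_eqF.
  ring.
apply/andP; split.
  rewrite normr_gt0 mulf_neq0 ?(gt_eqF y_gt0) //; apply/eqP => eq0; apply: irr.
  exists ((fl m' - fl m)%:R / (m' - m)%:R) => //.
  rewrite fmorph_div !rmorph_nat.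
  have mm0 : (m' - m)%:R != 0 :> R by rewrite pnatr_eq0 subn_eq0 -ltnNge.
  apply: (mulIf mm0); rewrite divfK // natrB // natrB ?(ltnW mm') //.
  by move: eq0; rewrite /fr; lra.
rewrite normrM gtr0_norm //; apply: le_lt_trans yN; rewrite ler_pM2l //.
have N_gt0 : 0 < N%:R :> R by rewrite ltr0n.
rewrite -[leRHS]mul1r ler_pdivlMr // -[X in _ * X]gtr0_norm // -normrM.
have Nfr_ge0 k : 0 <= N%:R * fr k by rewrite mulr_ge0 ?ler0n.
have /andP[] := truncn_itv (Nfr_ge0 m); have /andP[] := truncn_itv (Nfr_ge0 m').
rewrite -same -natr1 ler_norml; lra.
Qed.

(** Starting from the first multiple [n * hi] beyond [u], replacing copies of [hi]
    by [lo] one at a time moves down in steps of [hi - lo < d], hence hits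
    [u, u + d]. The descent is at most [hi] long, so it takes at most
    [hi / (hi - lo)] steps, which [n] allows once [u] is large. *)
Lemma gap_combination (lo hi d : R) : 0 <= lo -> lo < hi -> hi - lo < d ->
  exists A, forall u, A <= u -> exists k l : nat,
    u <= k%:R * hi + l%:R * lo <= u + d.
Proof.
move=> lo_ge0 lo_hi gap_lt; pose e := hi - lo.
have e_gt0 : 0 < e by rewrite subr_gt0.
have hi_gt0 : 0 < hi := le_lt_trans lo_ge0 lo_hi.
exists (hi * (hi / e)) => u uA.
have u_ge0 : 0 <= u by apply: le_trans uA; rewrite ltW // mulr_gt0 // divr_gt0.
have u_hi_ge0 : 0 <= u / hi by rewrite divr_ge0 // ltW.
pose n := (Num.truncn (u / hi)).+1.
have /andP[n_le n_gt] := truncn_itv u_hi_ge0; rewrite -/n in n_gt.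
have n_le' : n%:R * hi - u <= hi.
  move: n_le; rewrite ler_pdivlMr // /n -(natr1 (Num.truncn _)); lra.
have n_gt' : 0 < n%:R * hi - u by rewrite subr_gt0 -ltr_pdivrMr.
have r_ge0 : 0 <= (n%:R * hi - u) / e by rewrite divr_ge0 ?ltW.
pose l := Num.truncn ((n%:R * hi - u) / e).
have /andP[l_le l_gt] := truncn_itv r_ge0; rewrite -/l in l_le l_gt.
have ln : (l <= n)%N.
  rewrite -(ler_nat R); apply: (le_trans l_le).
  apply: (@le_trans _ _ (hi / e)); first by rewrite ler_pM2r ?invr_gt0.
  by apply: ltW; apply: le_lt_trans n_gt; rewrite ler_pdivlMr // mulrC.
exists (n - l)%N, l; rewrite natrB //.
have -> : (n%:R - l%:R) * hi + l%:R * lo = n%:R * hi - l%:R * e.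
  by rewrite /e; ring.
move: l_le l_gt; rewrite ler_pdivlMr // ltr_pdivrMr // -natr1 mulrDl mul1r.
move: gap_lt; rewrite -/e; lra.
Qed.

End IrrationalRatio.

(** * Limit superior of a bounded function *)

(** A limit superior at infinity together with a sequence realizing it; this
    form keeps the later arguments within sequences. *)
Lemma limsup_attained (R : realType) (f : R -> R) (m M : R) :
  (forall x, m <= f x) -> (forall x, f x <= M) ->
  exists (L : R) (u : nat -> R), [/\ u k @[k --> \oo] --> +oo,
    f (u k) @[k --> \oo] --> L &
    forall e, 0 < e -> \forall x \near +oo, f x <= L + e].
Proof.
move=> f_ge f_le.
pose S := [set c | \forall x \near +oo, f x <= c].
have S_inf : has_inf S.
  split; first by exists M; near=> x; exact: f_le.
  exists m => c /filter_ex[x]; exact: le_trans (f_ge x).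
have upper e : 0 < e -> \forall x \near +oo, f x <= inf S + e.
  move=> e_gt0; have [c Sc c_lt] := inf_adherent e_gt0 S_inf.
  by move: Sc; apply: filterS => x /le_trans; apply; exact: ltW.
have /boolp.choice[u uP] (k : nat) : exists x : R,
    k%:R <= x /\ inf S - k.+1%:R^-1 <= f x.
  apply: contrapT => none.
  have : S (inf S - k.+1%:R^-1).
    have := nbhs_pinfty_ge (num_real (k%:R : R)); apply: filterS => x kx.
    rewrite leNgt; apply/negP => lt; apply: none; exists x.
    by split=> //; exact: ltW.
  move/(ge_inf S_inf.2); rewrite lerBrDr gerDl.
  by rewrite leNgt invr_gt0 ltr0n.
have u_oo : u k @[k --> \oo] --> +oo.
  apply/cvgryPge => X; near=> k; apply: (le_trans _ (uP k).1).
  by near: k; exact: nbhs_infty_ger.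
exists (inf S), u; split=> //.
apply/cvgrPdist_le => e e_gt0.
have up : \forall k \near \oo, f (u k) <= inf S + e.
  exact: (u_oo _ (upper _ e_gt0)).
near=> k; rewrite ler_distl lerBlDr; apply/andP; split; first by near: k.
have inv_lt : k.+1%:R^-1 < e.
  by near: k; exact: near_infty_natSinv_lt (PosNum e_gt0).
by have := (uP k).2; rewrite lerBlDr => /le_trans; apply; rewrite lerD2l ltW.
Unshelve. all: by end_near.
Qed.

(** * Counting sequences by weight *)

Section Renewal.
Set Implicit Arguments.
Unset Strict Implicit.
Variables (R : realType) (I : finType) (a : I -> R).
Hypothesis a_gt0 : forall i, 0 < a i.

Definition weight (s : seq I) : R := \sum_(i <- s) a i.

Lemma weight_nil : weight [::] = 0.
Proof. by rewrite /weight big_nil. Qed.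

Lemma weight_cons i s : weight (i :: s) = a i + weight s.
Proof. by rewrite /weight big_cons. Qed.

Lemma weight_cat s t : weight (s ++ t) = weight s + weight t.
Proof. by rewrite /weight big_cat. Qed.

Lemma weight_nseq m i : weight (nseq m i) = m%:R * a i.
Proof. by rewrite /weight big_nseq iter_addr_0 mulr_natl. Qed.

Lemma weight_ge0 s : 0 <= weight s.
Proof. by apply: sumr_ge0 => i _; exact: ltW. Qed.

Fixpoint words_upto (m : nat) : seq (seq I) :=
  if m is m'.+1 then
    [::] :: [seq i :: s | i <- enum I, s <- words_upto m']
  else [:: [::]].

Lemma mem_words_upto m s : (s \in words_upto m) = (size s <= m)%N.
Proof.
elim: m s => [|m IHm] [|i s] //=.
rewrite in_cons /=; apply/allpairsP/idP => [[[j t]] /= [_]|les].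
  by rewrite IHm => les [_ ->].
by exists (i, s); rewrite /= mem_enum IHm.
Qed.

Lemma words_upto_uniq m : uniq (words_upto m).
Proof.
elim: m => //= m IHm; apply/andP; split.
  by apply/allpairsP => -[[i s] []].
apply: allpairs_uniq; rewrite ?enum_uniq // => -[i s] [j t] _ _ /= [-> ->] //.
Qed.

(** Since each [a i] times the sum of the [(a j)^-1] is at least 1, this bounds
    the length of the sequences of weight at most [x]. *)
Definition length_bound (x : R) : nat := Num.truncn ((\sum_i (a i)^-1) * x).

Lemma size_le_length_bound s x :
  weight s <= x -> (size s <= length_bound x)%N.
Proof.
move=> sx.
have sum_ge0 : 0 <= \sum_i (a i)^-1.
  by apply: sumr_ge0 => i _; rewrite invr_ge0 ltW.
have x_ge0 : 0 <= x := le_trans (weight_ge0 s) sx.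
rewrite truncn_ge_nat ?mulr_ge0 //.
apply: (le_trans _ (ler_wpM2l sum_ge0 sx)).
elim: s {x sx x_ge0} => [|i s IHs]; first by rewrite weight_nil mulr0.
rewrite weight_cons mulrDr /= -(addn1 (size s)) natrD addrC lerD //.
rewrite -[leLHS](mulVf (lt0r_neq0 (a_gt0 i))) ler_wpM2r ?(ltW (a_gt0 i)) //.
rewrite (bigD1 i) //= lerDl; apply: sumr_ge0 => j _.
by rewrite invr_ge0 ltW.
Qed.

Definition light_words (x : R) : seq (seq I) :=
  [seq s <- words_upto (length_bound x) | weight s <= x].

Lemma mem_light_words x s : (s \in light_words x) = (weight s <= x).
Proof.
rewrite mem_filter mem_words_upto andbC; apply: andb_idl.
exact: size_le_length_bound.
Qed.

Lemma light_words_uniq x : uniq (light_words x).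
Proof. by rewrite filter_uniq // words_upto_uniq. Qed.

Lemma light_words_lt0 x : x < 0 -> light_words x = [::].
Proof.
move=> x_lt0; apply/eqP; rewrite -size_eq0 -leqn0 leqNgt -has_predT.
apply/hasPn => s; rewrite mem_light_words => sx.
by have := le_lt_trans (le_trans (weight_ge0 s) sx) x_lt0; rewrite ltxx.
Qed.

(** A nonempty sequence is a first letter followed by a sequence of smaller
    weight; this is the source of the renewal equation. *)
Lemma light_words_rec x : 0 <= x ->
  perm_eq (light_words x)
    ([::] :: [seq i :: s | i <- enum I, s <- light_words (x - a i)]).
Proof.
move=> x_ge0; apply: uniq_perm; rewrite ?light_words_uniq //=.
  apply/andP; split; first by apply/allpairsPdep => -[i [s []]].
  apply: allpairs_uniq_dep => [|i _|]; rewrite ?enum_uniq ?light_words_uniq //.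
  by case=> i s [j t] _ _ /= [-> ->].
case=> [|i s]; first by rewrite mem_light_words weight_nil in_cons x_ge0.
rewrite mem_light_words weight_cons in_cons /=.
apply/idP/allpairsPdep => [sx|[j [t []]]].
  by exists i, s; rewrite mem_enum mem_light_words lerBrDl.
by rewrite mem_light_words lerBrDl => _ jtx [-> ->].
Qed.

Lemma sum_light_words_rec (f : seq I -> R) x : 0 <= x ->
  \sum_(s <- light_words x) f s =
    f [::] + \sum_i \sum_(s <- light_words (x - a i)) f (i :: s).
Proof.
move=> x_ge0; rewrite (perm_big _ (light_words_rec x_ge0)) big_cons /=.
by rewrite big_allpairs_dep big_enum.
Qed.

Lemma sum_light_words_split (f : seq I -> R) y x : y <= x ->
  \sum_(s <- light_words x) f s =
    \sum_(s <- light_words y) f s +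
    \sum_(s <- light_words x | y < weight s) f s.
Proof.
move=> yx; rewrite (bigID (fun s => weight s <= y)) /=; congr (_ + _).
  rewrite -big_filter; apply: perm_big; apply: uniq_perm.
  - by rewrite filter_uniq // light_words_uniq.
  - exact: light_words_uniq.
  move=> s; rewrite mem_filter !mem_light_words; apply: andb_idr => sy.
  exact: le_trans sy yx.
by apply: eq_bigl => s; rewrite ltNge.
Qed.

Definition word_count (x : R) : R := (size (light_words x))%:R.

Definition scaled_count (x : R) : R := expR (- x) * word_count x.

(** The integral of [scaled_count] over all reals up to [x]: each [s] contributes
    the integral of [expR (- t)] for [t] between [weight s] and [x]. The closed
    form makes its conservation law exact and avoids integration. *)
Definition cumulated_count (x : R) : R :=
  \sum_(s <- light_words x) (expR (- weight s) - expR (- x)).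

Lemma word_countE x : word_count x = \sum_(s <- light_words x) 1.
Proof. by rewrite big_const_seq count_predT iter_addr_0. Qed.

Lemma word_count_le y x : y <= x -> word_count y <= word_count x.
Proof.
move=> yx; rewrite ler_nat; apply: uniq_leq_size (light_words_uniq _) _ => s.
by rewrite !mem_light_words => /le_trans; exact.
Qed.

Lemma word_count_rec x : 0 <= x ->
  word_count x = 1 + \sum_i word_count (x - a i).
Proof.
move=> x_ge0; rewrite word_countE sum_light_words_rec //; congr (_ + _).
by apply: eq_bigr => i _; rewrite word_countE.
Qed.

Lemma scaled_count_ge0 x : 0 <= scaled_count x.
Proof. by rewrite mulr_ge0 ?expR_ge0 ?ler0n. Qed.

Lemma scaled_count_lt0 x : x < 0 -> scaled_count x = 0.
Proof.
by move=> x_lt0; rewrite /scaled_count /word_count light_words_lt0 ?mulr0.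
Qed.

Lemma scaled_count_rec x : 0 <= x ->
  scaled_count x =
    expR (- x) + \sum_i expR (- a i) * scaled_count (x - a i).
Proof.
move=> x_ge0; rewrite /scaled_count word_count_rec // mulrDr mulr1.
rewrite mulr_sumr; congr (_ + _); apply: eq_bigr => i _.
by rewrite mulrA -expRD; congr (expR _ * _); ring.
Qed.

(** The monotony of [word_count], read on [scaled_count]: it cannot drop quickly
    when its argument grows. *)
Lemma scaled_count_slow y x : y <= x ->
  expR (- (x - y)) * scaled_count y <= scaled_count x.
Proof.
move=> yx; rewrite mulrA -expRD.
have -> : - (x - y) - y = - x by ring.
by rewrite ler_wpM2l ?expR_ge0 // word_count_le.
Qed.

Lemma cumulated_count_diff y x : y <= x ->
  cumulated_count x - cumulated_count y =
    word_count y * (expR (- y) - expR (- x)) +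
    \sum_(s <- light_words x | y < weight s) (expR (- weight s) - expR (- x)).
Proof.
move=> yx; rewrite {1}/cumulated_count (sum_light_words_split _ yx) addrAC.
congr (_ + _); rewrite word_countE mulr_suml -sumrB; apply: eq_bigr => s _.
ring.
Qed.

(** With [cumulated_count_le], what is used of the fact that [cumulated_count]
    has derivative [scaled_count]: as [word_count] is nondecreasing, the integral
    over [y, x] is bounded by freezing it at either end. *)
Lemma cumulated_count_ge y x : y <= x ->
  scaled_count y * (1 - expR (- (x - y))) <=
    cumulated_count x - cumulated_count y.
Proof.
move=> yx; rewrite cumulated_count_diff //.
have -> : scaled_count y * (1 - expR (- (x - y))) =
    word_count y * (expR (- y) - expR (- x)).
  have -> : expR (- x) = expR (- y) * expR (- (x - y)).
    by rewrite -expRD; congr expR; ring.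
  rewrite /scaled_count; ring.
rewrite lerDl big_seq_cond; apply: sumr_ge0 => s /andP[].
by rewrite mem_light_words => sx _; rewrite subr_ge0 ler_expR lerN2.
Qed.

Lemma cumulated_count_le y x : y <= x ->
  cumulated_count x - cumulated_count y <=
    scaled_count x * (expR (x - y) - 1).
Proof.
move=> yx; rewrite cumulated_count_diff //.
have -> : scaled_count x * (expR (x - y) - 1) =
    word_count x * (expR (- y) - expR (- x)).
  have -> : expR (- y) = expR (- x) * expR (x - y).
    by rewrite -expRD; congr expR; ring.
  rewrite /scaled_count; ring.
rewrite (word_countE x) (sum_light_words_split _ yx) -word_countE mulrDl lerD2l.
rewrite mulr_suml; apply: ler_sum => s ys.
by rewrite mul1r lerD2r ler_expR lerN2 ltW.
Qed.

Hypothesis sum_expR : \sum_i expR (- a i) = 1.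

(** The conservation law that identifies the limit. As the [expR (- a i)]
    sum to 1, the left-hand side is [cumulated_count x] minus the average of the
    [cumulated_count (x - a i)]; the latter is exactly the contribution of the
    nonempty sequences to the former, and that of the empty one remains. *)
Lemma cumulated_count_rec x : 0 <= x ->
  \sum_i expR (- a i) * (cumulated_count x - cumulated_count (x - a i)) =
    1 - expR (- x).
Proof.
move=> x_ge0; rewrite (eq_bigr _ (fun i _ => mulrBr _ _ _)) sumrB.
rewrite -mulr_suml sum_expR mul1r {1}/cumulated_count sum_light_words_rec //.
rewrite weight_nil oppr0 expR0 -addrA -[RHS]addr0; congr (_ + _).
apply/eqP; rewrite subr_eq0; apply/eqP/eq_bigr => i _.
rewrite mulr_sumr; apply: eq_bigr => s _.
by rewrite weight_cons mulrBr -!expRD; congr (expR _ - expR _); ring.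
Qed.

(** * Renewal theorem *)

Lemma weights_eventually_dense (i j : I) : irrational (a i / a j) ->
  forall d : R, 0 < d -> exists A, forall u, A <= u -> exists s,
    u <= weight s <= u + d.
Proof.
move=> irr d d_gt0.
have [m [k /andP[gap_gt0 gap_lt]]] :=
  small_combination (a_gt0 i) (a_gt0 j) irr d_gt0.
have ma_ge0 (n : nat) c : 0 <= n%:R * a c by rewrite mulr_ge0 ?ler0n ?ltW.
case: (ltrgtP (k%:R * a j) (m%:R * a i)) => [lt|lt|eq].
- have [|A dense] := @gap_combination _ _ _ d (ma_ge0 k j) lt.
    by move: gap_lt; rewrite gtr0_norm ?subr_gt0.
  exists A => u /dense[n [l nl]]; exists (nseq (n * m) i ++ nseq (l * k) j).
  by rewrite weight_cat !weight_nseq !natrM -!mulrA.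
- have [|A dense] := @gap_combination _ _ _ d (ma_ge0 m i) lt.
    by move: gap_lt; rewrite ltr0_norm ?subr_lt0 // opprB.
  exists A => u /dense[n [l nl]]; exists (nseq (n * k) j ++ nseq (l * m) i).
  by rewrite weight_cat !weight_nseq !natrM -!mulrA.
- by move: gap_gt0; rewrite eq subrr normr0 ltxx.
Qed.

Hypothesis weights_dense : forall d : R, 0 < d ->
  exists A, forall u, A <= u -> exists s, u <= weight s <= u + d.

Lemma expR_ge_mul (h : R) : h * expR (- h) <= 1 - expR (- h).
Proof.
have : (1 + h) * expR (- h) <= 1.
  rewrite -[leRHS](expRxMexpNx_1 h) ler_wpM2r ?expR_ge0 //.
  exact: expR_ge1Dx.
lra.
Qed.

Lemma expR_le_mul (h : R) : expR h - 1 <= h * expR h.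
Proof. by have := expR_ge_mul (- h); rewrite opprK; lra. Qed.

(** Riemann sums for the increment of [cumulated_count] over a window of length
    [d], with mesh [h <= e] and sampling points of the form [y - weight s].
    Here [b] selects a sequence of weight within [e] above a prescribed number.
    One factor [expR e] pays for freezing [word_count] on a cell, the other for
    moving the endpoint of the cell to the sampling point. The finitely many
    sequences involved do not depend on [y], so that one may then let [y]
    grow with each of them fixed. *)
Lemma increment_bounds (d e A : R) (b : R -> seq I) :
  0 < d -> 0 < e ->
  (forall u, A <= u -> u <= weight (b u) <= u + e) ->
  exists (m : nat) (h : R), m%:R * h = d /\ forall B y, A + e <= B ->
    expR (- (2 * e)) * (h * \sum_(j < m)
        scaled_count (y - weight (b (B + j.+1%:R * h))))
      <= cumulated_count (y - B) - cumulated_count (y - B - d)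
      <= expR (2 * e) * (h * \sum_(j < m)
        scaled_count (y - weight (b (B + j%:R * h - e)))).
Proof.
move=> d_gt0 e_gt0 bP.
pose m := (Num.truncn (d / e)).+1; pose h := d / m%:R.
have m_gt0 : 0 < m%:R :> R by rewrite ltr0n.
have h_gt0 : 0 < h by rewrite divr_gt0.
have he : h <= e.
  by rewrite ler_pdivrMr // mulrC -ler_pdivrMr // ltW // truncnS_gt.
have mh : m%:R * h = d by rewrite mulrC divfK ?gt_eqF.
exists m, h; split => // B y AB.
have jh_ge0 (j : nat) : 0 <= j%:R * h by rewrite mulr_ge0 ?ler0n ?ltW.
pose t (j : nat) := y - B - j%:R * h.
have tS j : t j = t j.+1 + h by rewrite /t -natr1; ring.
have -> : cumulated_count (y - B) - cumulated_count (y - B - d) =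
    \sum_(j < m) (cumulated_count (t j) - cumulated_count (t j.+1)).
  have -> : y - B - d = t m by rewrite /t mh.
  have -> : y - B = t 0%N by rewrite /t mul0r subr0.
  rewrite -(big_mkord predT (fun j => cumulated_count (t j)
                                      - cumulated_count (t j.+1))) /=.
  rewrite -opprB -(telescope_sumr (fun j => cumulated_count (t j))) //.
  by rewrite -sumrN; apply: eq_bigr => j _; rewrite opprB.
rewrite !mulr_sumr; apply/andP; split; apply: ler_sum => j _.
- have /bP/andP[ge le] : A <= B + j.+1%:R * h.
    by have := jh_ge0 j.+1; lra.
  set w := weight _ in ge le *.
  have tw : y - w <= t j.+1 by rewrite /t; lra.
  have tt : t j.+1 <= t j by rewrite (tS j); lra.
  apply: le_trans (cumulated_count_ge tt).
  have -> : t j - t j.+1 = h by rewrite (tS j); ring.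
  have Zw := scaled_count_slow tw.
  have Zw' : expR (- e) * scaled_count (y - w) <= scaled_count (t j.+1).
    apply: le_trans Zw; rewrite ler_wpM2r ?scaled_count_ge0 //.
    rewrite ler_expR /t; lra.
  have -> : expR (- (2 * e)) * (h * scaled_count (y - w)) =
      (expR (- e) * scaled_count (y - w)) * (h * expR (- e)).
    have -> : - (2 * e) = - e - e by ring.
    rewrite expRD; ring.
  apply: ler_pM Zw' _.
  - exact: mulr_ge0 (expR_ge0 _) (scaled_count_ge0 _).
  - exact: mulr_ge0 (ltW h_gt0) (expR_ge0 _).
  apply: le_trans (expR_ge_mul h); rewrite ler_wpM2l ?(ltW h_gt0) //.
  by rewrite ler_expR; lra.
- have /bP/andP[ge le] : A <= B + j%:R * h - e.
    by have := jh_ge0 j; lra.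
  set w := weight _ in ge le *.
  have tw : t j <= y - w by rewrite /t; lra.
  have tt : t j.+1 <= t j by rewrite (tS j); lra.
  apply: (le_trans (cumulated_count_le tt)).
  have -> : t j - t j.+1 = h by rewrite (tS j); ring.
  have Zw := scaled_count_slow tw.
  have Zw' : scaled_count (t j) <= expR e * scaled_count (y - w).
    rewrite -[leLHS]mul1r -(expRxMexpNx_1 e) -mulrA ler_wpM2l ?expR_ge0 //.
    apply: le_trans Zw; rewrite ler_wpM2r ?scaled_count_ge0 //.
    rewrite ler_expR /t; lra.
  have -> : expR (2 * e) * (h * scaled_count (y - w)) =
      (expR e * scaled_count (y - w)) * (h * expR e).
    have -> : 2 * e = e + e by ring.
    rewrite expRD; ring.
  have h1 : 0 <= expR h - 1 by have := expR_ge1Dx h; lra.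
  apply: ler_pM (scaled_count_ge0 _) h1 Zw' _.
  apply: (le_trans (expR_le_mul h)); rewrite ler_wpM2l ?(ltW h_gt0) //.
  by rewrite ler_expR.
Qed.

(** If [scaled_count] has the same limit [L] along all the shifts of [u] by
    weights, then by [increment_bounds] the conservation law, evaluated at a
    fixed distance [B] before [u k], tends to [L] times the mean weight, up to
    factors as close to 1 as desired; and its value tends to 1. *)
Lemma shifts_limit_mul_mean (L : R) (u : nat -> R) :
  u k @[k --> \oo] --> +oo ->
  (forall s, scaled_count (u k - weight s) @[k --> \oo] --> L) ->
  L * \sum_i expR (- a i) * a i = 1.
Proof.
move=> u_oo Zu; set c := L * _.
have bounds e : 0 < e -> expR (- (2 * e)) * c <= 1 <= expR (2 * e) * c.
  move=> e_gt0.
  have [A dense] := weights_dense e_gt0.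
  have /boolp.choice[b bP] : forall v, exists s : seq I,
      A <= v -> v <= weight s <= v + e.
    by move=> v; have [/dense[s sP]|_] := boolP (A <= v);
      [exists s|exists [::]].
  have /boolp.choice[m /boolp.choice[h mhP]] i :=
    increment_bounds (a_gt0 i) e_gt0 bP.
  pose B := A + e.
  pose lower k := \sum_i expR (- a i) * (expR (- (2 * e)) *
    (h i * \sum_(j < m i)
       scaled_count (u k - weight (b (B + j.+1%:R * h i))))).
  pose upper k := \sum_i expR (- a i) * (expR (2 * e) *
    (h i * \sum_(j < m i)
       scaled_count (u k - weight (b (B + j%:R * h i - e))))).
  pose middle k := \sum_i expR (- a i) *
    (cumulated_count (u k - B) - cumulated_count (u k - B - a i)).
  have sum_lim (E : R) (w : I -> nat -> seq I) :
    \sum_i expR (- a i) * (E * (h i * \sum_(j < m i)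
      scaled_count (u k - weight (w i j)))) @[k --> \oo] --> E * c.
    have -> : E * c = \sum_i expR (- a i) * (E * (h i * \sum_(j < m i) L)).
      rewrite /c !mulr_sumr; apply: eq_bigr => i _.
      have [mh _] := mhP i; rewrite sumr_const card_ord -(mulr_natl L).
      by set q := expR _; rewrite -mh; ring.
    apply: (cvg_big add_continuous) => i _; do 3 apply: cvgMl_tmp.
    by apply: (cvg_big add_continuous) => j _; exact: Zu.
  have lower_lim : lower k @[k --> \oo] --> expR (- (2 * e)) * c.
    exact: (sum_lim _ (fun i j => b (B + j.+1%:R * h i))).
  have upper_lim : upper k @[k --> \oo] --> expR (2 * e) * c.
    exact: (sum_lim _ (fun i j => b (B + j%:R * h i - e))).
  have uB_oo : u k - B @[k --> \oo] --> +oo.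
    apply/cvgryPge => X; have /cvgryPge/(_ (X + B)) := u_oo.
    by apply: filterS => k; rewrite lerBrDr.
  have middle_lim : middle k @[k --> \oo] --> (1 : R).
    have lim1 : 1 - expR (- (u k - B)) @[k --> \oo] --> (1 : R).
      rewrite -[X in _ --> X]subr0; apply: cvgB; first exact: cvg_cst.
      exact: (cvg_comp _ _ uB_oo (@cvgr_expR R)).
    apply: cvg_trans lim1; apply: near_eq_cvg.
    have /cvgryPge/(_ 0) := uB_oo; apply: filterS => k uB_ge0.
    by rewrite /middle cumulated_count_rec.
  have le_lower : \forall k \near \oo, lower k <= middle k.
    near=> k; apply: ler_sum => i _; rewrite ler_wpM2l ?expR_ge0 //.
    by have [_ /(_ B (u k) (lexx _))/andP[]] := mhP i.
  have le_upper : \forall k \near \oo, middle k <= upper k.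
    near=> k; apply: ler_sum => i _; rewrite ler_wpM2l ?expR_ge0 //.
    by have [_ /(_ B (u k) (lexx _))/andP[]] := mhP i.
  apply/andP; split.
  - exact: ler_cvg_to lower_lim middle_lim le_lower.
  - exact: ler_cvg_to middle_lim upper_lim le_upper.
have c_gt0 : 0 < c.
  have /andP[_ c1] := bounds 1 ltr01.
  by rewrite -(pmulr_rgt0 _ (expR_gt0 (2 * 1))) (lt_le_trans ltr01 c1).
have ln_le e : 0 < e -> `|ln c| <= 2 * e.
  move=> /bounds; rewrite -{1 2}(lnK c_gt0) -!expRD -expR0 !ler_expR ler_norml.
  by move=> /andP[? ?]; apply/andP; split; lra.
have : `|ln c| <= 0.
  apply/ler_addgt0Pr => e e_gt0; rewrite add0r.
  have e2_gt0 : 0 < e / 2 by rewrite divr_gt0.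
  by apply: (le_trans (ln_le _ e2_gt0)); rewrite mulrC divfK.
by rewrite normr_le0 => /eqP lnc; rewrite -(lnK c_gt0) lnc expR0.
Unshelve. all: by end_near.
Qed.

(** An average with positive coefficients of numbers asymptotically at most [L]
    can tend to [L] only if each of them tends to [L]. *)
Lemma limsup_persists (f : R -> R) (L : R) (u : nat -> R) :
  (forall e, 0 < e -> \forall x \near +oo, f x <= L + e) ->
  f x - \sum_i expR (- a i) * f (x - a i) @[x --> +oo] --> (0 : R) ->
  u k @[k --> \oo] --> +oo -> f (u k) @[k --> \oo] --> L ->
  forall i, f (u k - a i) @[k --> \oo] --> L.
Proof.
move=> f_le f_rec u_oo fu i; apply/cvgrPdist_le => e e_gt0.
have q_gt0 := expR_gt0 (- a i).
have q_le1 : expR (- a i) <= 1 by rewrite expR_le1 oppr_le0 ltW.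
(* The error on the [i]th term is [3 * d / expR (- a i)]: one [d] each from
   [f (u k)], from the recurrence and from the other terms. *)
pose d := expR (- a i) * e / 3.
have d_gt0 : 0 < d by rewrite divr_gt0 // mulr_gt0.
have de : d <= e.
  have : expR (- a i) * e <= e by rewrite ler_piMl // ltW.
  rewrite /d; lra.
have shift_oo j : u k - a j @[k --> \oo] --> +oo.
  apply/cvgryPge => X; have /cvgryPge/(_ (X + a j)) := u_oo.
  by apply: filterS => k; rewrite lerBrDr.
have rec_u : \forall k \near \oo,
    `|f (u k) - \sum_i expR (- a i) * f (u k - a i)| <= d.
  exact: (u_oo _ (cvgr0_norm_le _ f_rec _ d_gt0)).
have le_u : \forall k \near \oo, forall j, f (u k - a j) <= L + d.
  by apply: filter_forall => j; exact: (shift_oo j _ (f_le _ d_gt0)).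
have ge_u : \forall k \near \oo, L - d <= f (u k).
  by apply: (cvgr_ge _ fu); rewrite ltrBlDr ltrDl.
near=> k.
have ub : forall j, f (u k - a j) <= L + d by near: k.
have rec : `|f (u k) - \sum_i expR (- a i) * f (u k - a i)| <= d by near: k.
have lb : L - d <= f (u k) by near: k.
have others : \sum_(j | j != i) expR (- a j) * f (u k - a j) <=
    (1 - expR (- a i)) * (L + d).
  rewrite -sum_expR [in leRHS](bigD1 i) //= [in leRHS]addrAC subrr add0r.
  by rewrite mulr_suml; apply: ler_sum => j _; rewrite ler_wpM2l ?expR_ge0.
rewrite ler_distl; apply/andP; split.
  have q_ge0 := ltW q_gt0; have := ub i; lra.
move: rec; rewrite (bigD1 i) //= ler_norml => /andP[_ rec].
rewrite -lerBlDr -(ler_pM2l q_gt0) mulrBr.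
have -> : expR (- a i) * e = 3 * d by rewrite /d; field.
have qd : 0 <= expR (- a i) * d by rewrite mulr_ge0 ?ltW.
lra.
Unshelve. all: by end_near.
Qed.

Lemma limsup_persists_weight (f : R -> R) (L : R) :
  (forall e, 0 < e -> \forall x \near +oo, f x <= L + e) ->
  f x - \sum_i expR (- a i) * f (x - a i) @[x --> +oo] --> (0 : R) ->
  forall (s : seq I) (u : nat -> R),
  u k @[k --> \oo] --> +oo -> f (u k) @[k --> \oo] --> L ->
  f (u k - weight s) @[k --> \oo] --> L.
Proof.
move=> f_le f_rec; elim=> [|i s IHs] u u_oo fu.
  by under eq_fun do rewrite weight_nil subr0.
under eq_fun do rewrite weight_cons opprD addrA.
apply: (IHs (fun k => u k - a i)); last exact: limsup_persists.
apply/cvgryPge => X; have /cvgryPge/(_ (X + a i)) := u_oo.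
by apply: filterS => k; rewrite lerBrDr.
Qed.

Lemma scaled_count_defect :
  scaled_count x - \sum_i expR (- a i) * scaled_count (x - a i)
    @[x --> +oo] --> (0 : R).
Proof.
apply: cvg_trans (@cvgr_expR R); apply: near_eq_cvg.
have := nbhs_pinfty_ge (num_real (0 : R)); apply: filterS => x x_ge0.
by rewrite (scaled_count_rec x_ge0) addrK.
Qed.

Lemma letter_exists : exists i : I, true.
Proof.
apply/existsP; rewrite -[X in is_true X]negbK negb_exists.
apply/negP => /forallP I0; have := @oner_neq0 R.
by rewrite -sum_expR big1 ?eqxx // => i; have := I0 i.
Qed.

(** In the conservation law every term is nonnegative and the sum is at most 1,
    so a single term already bounds [scaled_count]. *)
Lemma scaled_count_bounded : exists M, forall x, scaled_count x <= M.
Proof.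
have [i _] := letter_exists.
have q_gt0 := expR_gt0 (- a i).
have gap_gt0 : 0 < 1 - expR (- a i) by rewrite subr_gt0 expR_lt1 oppr_lt0.
exists (expR (- a i) * (1 - expR (- a i)))^-1 => x.
have M_gt0 : 0 < expR (- a i) * (1 - expR (- a i)) by exact: mulr_gt0.
have [x_lt0|x_ge0] := ltP x 0.
  by rewrite scaled_count_lt0 // invr_ge0 ltW.
rewrite -[leRHS]mul1r ler_pdivlMr // mulrCA.
have xa_ge0 : 0 <= x + a i by rewrite addr_ge0 // ltW.
have term_ge0 j : 0 <= expR (- a j) *
    (cumulated_count (x + a i) - cumulated_count (x + a i - a j)).
  have le_x : x + a i - a j <= x + a i by rewrite lerBlDr lerDl ltW.
  rewrite mulr_ge0 ?expR_ge0 //; apply: le_trans (cumulated_count_ge le_x).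
  by rewrite mulr_ge0 ?scaled_count_ge0 // subr_ge0 expR_le1 oppr_le0 subr_ge0.
apply: (@le_trans _ _ (1 - expR (- (x + a i)))); last first.
  by rewrite gerBl expR_ge0.
rewrite -(cumulated_count_rec xa_ge0) (bigD1 i) //=.
apply: ler_wpDr; first by apply: sumr_ge0 => j _; exact: term_ge0.
rewrite ler_wpM2l ?expR_ge0 // addrK.
have le_x : x <= x + a i by rewrite lerDl ltW.
have := cumulated_count_ge le_x.
by have -> : x + a i - x = a i by ring.
Qed.

(** The renewal theorem for [word_count]. The limit superior [L] of
    [scaled_count] and that of its opposite, [L'], satisfy
    [L * H = 1 = - L' * H], so the limits superior and inferior agree. *)
Theorem scaled_count_cvg :
  scaled_count x @[x --> +oo] --> (\sum_i expR (- a i) * a i)^-1.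
Proof.
set H := \sum_i _.
have [M Z_le] := scaled_count_bounded.
have [L [u [u_oo Zu Z_leL]]] := limsup_attained scaled_count_ge0 Z_le.
have LH : L * H = 1.
  apply: (shifts_limit_mul_mean u_oo) => s.
  exact: (limsup_persists_weight Z_leL scaled_count_defect).
have NZ_ge x : - M <= - scaled_count x by rewrite lerN2.
have NZ_le x : - scaled_count x <= 0 by rewrite oppr_le0 scaled_count_ge0.
have [L' [u' [u'_oo Zu' Z_leL']]] := limsup_attained NZ_ge NZ_le.
have L'H : - L' * H = 1.
  apply: (shifts_limit_mul_mean u'_oo) => s.
  under eq_fun do rewrite -[scaled_count _]opprK.
  apply: cvgN; apply: (limsup_persists_weight Z_leL' _ s u'_oo Zu').
  rewrite -[X in _ --> X]oppr0.
  apply: cvg_trans (cvgN scaled_count_defect); apply: near_eq_cvg.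
  near=> x; rewrite [X in _ = _ - X](_ : _ =
      - \sum_i expR (- a i) * scaled_count (x - a i)).
    by rewrite opprB opprK addrC.
  by rewrite -sumrN; apply: eq_bigr => i _; rewrite mulrN.
have H_neq0 : H != 0.
  by apply/eqP => H0; have := oner_neq0 R; rewrite -LH H0 mulr0 eqxx.
have -> : H^-1 = L by apply: (mulIf H_neq0); rewrite mulVf.
have L'E : L' = - L.
  by apply: oppr_inj; apply: (mulIf H_neq0); rewrite L'H opprK LH.
apply/cvgrPdist_le => e e_gt0; near=> x.
have up : scaled_count x <= L + e by near: x; exact: Z_leL.
have lo : - scaled_count x <= L' + e by near: x; exact: Z_leL'.
rewrite ler_distl; move: lo; rewrite L'E; lra.
Unshelve. all: by end_near.
Qed.

Lemma mean_weight_gt0 : 0 < \sum_i expR (- a i) * a i.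
Proof.
have [i _] := letter_exists.
rewrite (bigD1 i) //= ltr_wpDr ?mulr_gt0 ?expR_gt0 //.
by apply: sumr_ge0 => j _; rewrite mulr_ge0 ?expR_ge0 // ltW.
Qed.

(** * From counts to ranks *)

Section RankedWords.
Variable v : nat -> seq I.
Hypothesis v_bij : set_bij [set r | (0 < r)%N] setT v.
Hypothesis v_sorted :
  forall r s, (0 < r)%N -> (r <= s)%N -> weight (v r) <= weight (v s).

Lemma rank_le_word_count r : r%:R <= word_count (weight (v r)).
Proof.
rewrite ler_nat -{1}(size_iota 1 r) -(size_map v).
have [_ v_inj _] := v_bij.
apply: uniq_leq_size => [|s /mapP[k]]; last first.
  rewrite mem_iota add1n ltnS => /andP[k_gt0 kr] ->.
  by rewrite mem_light_words v_sorted.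
rewrite map_inj_in_uniq ?iota_uniq // => k l; rewrite !mem_iota.
move=> /andP[k_gt0 _] /andP[l_gt0 _]; apply: v_inj; exact: mem_set.
Qed.

Lemma word_count_lt_rank r y : (0 < r)%N -> y < weight (v r) ->
  word_count y < r%:R.
Proof.
case: r => // r _ y_lt; rewrite ltr_nat ltnS -(size_iota 1 r) -(size_map v).
apply: uniq_leq_size (light_words_uniq y) _ => s; rewrite mem_light_words => sy.
have [_ _ v_surj] := v_bij; have [k k_gt0 vk] := v_surj s Logic.I.
apply/mapP; exists k => //; rewrite mem_iota add1n ltnS k_gt0 /= leqNgt.
apply/negP => /(v_sorted (ltn0Sn _)); rewrite vk => /(lt_le_trans y_lt).
by rewrite ltNge sy.
Qed.

(** With [t] the weight of the [r]th sequence, [r <= word_count t] bounds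
    [expR t / r] below by [(scaled_count t)^-1], and [word_count (t - d) < r]
    bounds it above by [expR d * (scaled_count (t - d))^-1]; the slack [d > 0]
    absorbs the sequences of equal weight, whose mutual order is arbitrary. *)
Theorem ranked_weight_cvg :
  expR (weight (v r)) / r%:R @[r --> \oo] --> \sum_i expR (- a i) * a i.
Proof.
set H := \sum_i _; have H_gt0 : 0 < H by exact: mean_weight_gt0.
have t_oo : weight (v r) @[r --> \oo] --> +oo.
  apply/cvgryPge => X; near=> r; rewrite leNgt; apply/negP => tX.
  have : word_count X < r%:R by near: r; exact: nbhs_infty_gtr.
  by rewrite ltNge (le_trans (rank_le_word_count r)) // word_count_le // ltW.
have invZ_cvg : (scaled_count x)^-1 @[x --> +oo] --> H.
  rewrite -[H]invrK; apply: cvgV; first by rewrite invr_eq0 gt_eqF.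
  exact: scaled_count_cvg.
apply/cvgrPdist_le => e e_gt0.
(* This choice gives [expR d * H = H + e / 2]. *)
pose d := ln (1 + e / (2 * H)).
have eH_gt0 : 0 < e / (2 * H) by rewrite divr_gt0 // mulr_gt0.
have d_gt0 : 0 < d by rewrite ln_gt0 // ltrDl.
have td_oo : weight (v r) - d @[r --> \oo] --> +oo.
  apply/cvgryPge => X; have /cvgryPge/(_ (X + d)) := t_oo.
  by apply: filterS => r; rewrite lerBrDr.
have lower : \forall r \near \oo,
    H - e <= (scaled_count (weight (v r)))^-1.
  apply: (cvgr_ge _ (cvg_comp _ _ t_oo invZ_cvg)); by rewrite ltrBlDr ltrDl.
have upper : \forall r \near \oo,
    expR d * (scaled_count (weight (v r) - d))^-1 <= H + e.
  have lim : expR d * (scaled_count (weight (v r) - d))^-1 @[r --> \oo] -->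
      expR d * H.
    by apply: cvgMl_tmp; exact: (cvg_comp _ _ td_oo invZ_cvg).
  apply: (cvgr_le _ lim).
  rewrite lnK ?posrE ?addr_gt0 // mulrDl mul1r ltrD2l.
  have -> : e / (2 * H) * H = e / 2 by field; rewrite gt_eqF.
  by rewrite ltr_pdivrMr // mulr_natr mulr2n ltrDl.
have Z_gt0 : \forall r \near \oo, 0 < (scaled_count (weight (v r) - d))^-1.
  exact: (cvgr_gt _ (cvg_comp _ _ td_oo invZ_cvg)).
near=> r.
have r_gt0 : (0 < r)%N by near: r; exact: nbhs_infty_gt.
have rR_gt0 : 0 < r%:R :> R by rewrite ltr0n.
rewrite ler_distlC; apply/andP; split.
  have : H - e <= (scaled_count (weight (v r)))^-1 by near: r.
  move=> /le_trans; apply.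
  have N_gt0 : 0 < word_count (weight (v r)).
    exact: lt_le_trans (rank_le_word_count r).
  rewrite /scaled_count invfM -expRN opprK ler_pM2l ?expR_gt0 //.
  by rewrite lef_pV2 ?posrE // rank_le_word_count.
have : expR d * (scaled_count (weight (v r) - d))^-1 <= H + e by near: r.
apply: le_trans.
have : 0 < (scaled_count (weight (v r) - d))^-1 by near: r.
rewrite invr_gt0 /scaled_count pmulr_rgt0 ?expR_gt0 // => N_gt0.
rewrite invfM -expRN opprK mulrA -expRD addrC subrK ler_pM2l ?expR_gt0 //.
rewrite lef_pV2 ?posrE // ltW // word_count_lt_rank //.
by rewrite ltrBlDr ltrDl.
Unshelve. all: by end_near.
Qed.
End RankedWords.
End Renewal.

(** * Words ended by a stop symbol *)

Section StoppedWords.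
Variables (R : realType) (n : nat) (p : 'I_n.+1 -> R).
Hypothesis p_gt0 : forall x, 0 < p x.

Lemma wordsP (w : seq 'I_n.+1) :
  words n w <-> exists v, w = rcons (map (lift ord0) v) ord0.
Proof.
split=> [[s s_free ->]|[v ->]]; last first.
  exists (map (lift ord0) v) => //; apply/mapP => -[i _ /eqP].
  by rewrite (negPf (neq_lift _ _)).
suff [v ->] : exists v, s = map (lift ord0) v by exists v.
elim: s s_free => [|x s IHs]; first by exists [::].
rewrite in_cons negb_or => /andP[/unlift_some[i -> _] /IHs[v ->]].
by exists (i :: v).
Qed.

Lemma word_prob_gt0 w : 0 < word_prob p w.
Proof. by apply: prodr_gt0. Qed.

(** The change of variables of the whole proof: the weight is, up to an additive
    constant, [- gamma] times the logarithm of the word probability. *)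
Lemma weight_word_prob (gamma : R) v :
  weight (fun i => - gamma * ln (p (lift ord0 i))) v =
    gamma * (ln (p ord0) - ln (word_prob p (rcons (map (lift ord0) v) ord0))).
Proof.
elim: v => [|i v IHv].
  by rewrite weight_nil /word_prob big_seq1 subrr mulr0.
rewrite weight_cons IHv /word_prob /= big_cons lnM ?posrE //; last first.
  exact: word_prob_gt0.
ring.
Qed.

Hypothesis p_sum1 : \sum_x p x = 1.

Lemma letter_prob_lt1 i : p (lift ord0 i) < 1.
Proof.
rewrite -p_sum1 big_ord_recl (bigD1 i) //= addrCA ltrDl.
by apply: ltr_wpDr (p_gt0 _); apply: sumr_ge0 => j _; exact: ltW.
Qed.

(** For a nonpositive exponent every summand is at least 1, so two letters
    already make the sum exceed 1. *)
Lemma exponent_gt0 (gamma : R) (i j : 'I_n) : i != j ->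
  \sum_k p (lift ord0 k) `^ gamma = 1 -> 0 < gamma.
Proof.
move=> ij root; rewrite ltNge; apply/negP => gamma_le0.
have ge1 k : 1 <= p (lift ord0 k) `^ gamma.
  rewrite /powR gt_eqF // -[leLHS]expR0 ler_expR mulr_le0 // ln_le0 // ltW //.
  exact: letter_prob_lt1.
move: root; rewrite (bigD1 i) //= (bigD1 j) /=; last by rewrite eq_sym.
have rest : 0 <= \sum_(k < n | (k != i) && (k != j)) p (lift ord0 k) `^ gamma.
  by apply: sumr_ge0 => k _; exact: powR_ge0.
by have := ge1 i; have := ge1 j; lra.
Qed.
End StoppedWords.

Theorem theorem1 (R : realType) (n : nat) (p : 'I_n.+1 -> R)
    (p_gt0 : forall x : 'I_n.+1, 0 < p x)
    (p_sum1 : \sum_(x < n.+1) p x = 1)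
    (w : nat -> seq 'I_n.+1)
    (w_list : sorted_word_list p w)
    (irr : exists i j : 'I_n,
       irrational (ln (p (lift ord0 i)) / ln (p (lift ord0 j))))
    (gamma : R)
    (gamma_root : \sum_(i < n) p (lift ord0 i) `^ gamma = 1) :
  let H := entropy (fun i : 'I_n => p (lift ord0 i) `^ gamma) in
  ((fun r : nat =>
      (word_prob p (w r) `^ (- gamma) / p ord0 `^ (- gamma)) / r%:R)
     @ \oo --> H) /\
  H = - gamma * \sum_(i < n) p (lift ord0 i) `^ gamma * ln (p (lift ord0 i)).
Proof.
move=> H.
have HE : H = - gamma * \sum_i p (lift ord0 i) `^ gamma * ln (p (lift ord0 i)).
  rewrite /H /entropy -sumrN mulr_sumr; apply: eq_bigr => i _.
  by rewrite ln_powR; ring.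
split=> //.
have [i [j irr_ij]] := irr.
have ln_lt0 k : ln (p (lift ord0 k)) < 0.
  by rewrite -ln1 ltr_ln ?posrE // letter_prob_lt1.
(* A ratio with [i = j] would be 1, so there are at least two letters. *)
have ij : i != j.
  apply/eqP => ij; apply: irr_ij; exists 1 => //.
  by rewrite ij divff ?rmorph1 // lt_eqF.
have gamma_gt0 : 0 < gamma := exponent_gt0 p_gt0 p_sum1 ij gamma_root.
pose a k := - gamma * ln (p (lift ord0 k)).
have a_gt0 k : 0 < a k by rewrite /a mulNr oppr_gt0 pmulr_rlt0.
have expRa k : expR (- a k) = p (lift ord0 k) `^ gamma.
  by rewrite /powR gt_eqF // /a mulNr opprK.
have sum_expR : \sum_k expR (- a k) = 1.
  by rewrite -[RHS]gamma_root; apply: eq_bigr => k _.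
have irr_a : irrational (a i / a j).
  by rewrite /a -mulf_div divff ?mul1r // oppr_eq0 gt_eqF.
have HaE : H = \sum_k expR (- a k) * a k.
  rewrite HE mulr_sumr; apply: eq_bigr => k _; rewrite expRa /a; ring.
have [w_bij w_sorted] := w_list.
have [w_word w_inj w_surj] := w_bij.
have /boolp.choice[v vP] r : exists v : seq 'I_n,
    (0 < r)%N -> w r = rcons (map (lift ord0) v) ord0.
  case: (posnP r) => [->|r_gt0]; first by exists [::].
  by have /wordsP[v ->] := w_word _ r_gt0; exists v.
have v_bij : set_bij [set r | (0 < r)%N] setT v.
  split=> // [r s|s _].
    move=> /set_mem r_gt0 /set_mem s_gt0 vrs.
    by apply: w_inj; rewrite ?inE // !vP // vrs.
  have /w_surj[r r_gt0 wr] : words n (rcons (map (lift ord0) s) ord0).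
    by apply/wordsP; exists s.
  exists r => //; move: wr; rewrite vP // => /rcons_inj[/inj_map]; apply.
  exact: lift_inj.
have weightE r : (0 < r)%N ->
    weight a (v r) = gamma * (ln (p ord0) - ln (word_prob p (w r))).
  by move=> r_gt0; rewrite vP // weight_word_prob.
have v_sorted r s : (0 < r)%N -> (r <= s)%N -> weight a (v r) <= weight a (v s).
  move=> r_gt0 rs; rewrite !weightE //; last exact: leq_trans rs.
  rewrite ler_pM2l // lerD2l lerN2 ler_ln ?posrE ?word_prob_gt0 //.
  exact: w_sorted.
rewrite HaE.
have := ranked_weight_cvg a_gt0 sum_expR (weights_eventually_dense a_gt0 irr_a)
  v_bij v_sorted.
apply: cvg_trans; apply: near_eq_cvg; near=> r.
have r_gt0 : (0 < r)%N by near: r; exact: nbhs_infty_gt.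
congr (_ / _); rewrite weightE // /powR !gt_eqF ?word_prob_gt0 //.
by rewrite -expRN -expRD; congr expR; ring.
Unshelve. all: by end_near.
Qed.
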